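(* Let $X$ be a Tychonoff space and let $\aleph_\alpha\geq\aleph_1$ be a cardinal. The following statements are equivalent: (1) $C_{\aleph_\alpha}(X)$ is completely metrizable. (2) $C_{\aleph_\alpha}(X)$ is a Čech-complete space. (3) $C_{\aleph_\alpha}(X)$ is locally Čech-complete. (4) $C_{\aleph_\alpha}(X)$ is an open continuous image of a paracompact Čech-complete space. (5) $C_{\aleph_\alpha}(X)$ is an open continuous image of a Čech-complete space. (6) $C_{\aleph_\alpha}(X)$ is of pointwise countable type. (7) $X$ is $\aleph_\alpha$-separable.
   Context: Tychonoff means completely regular and Hausdorff. A Tychonoff space $Y$ is Čech-complete if it is a $G_\delta$-subset of its Stone–Čech compactification $\beta Y$, and locally Čech-complete if every point has a Čech-complete neighborhood. A subset $S$ of a space $Y$ has countable character if there is a sequence $(W_n)_{n\in\mathbb{N}}$ of open sets containing $S$ such that every open set containing $S$ contains some $W_n$; $Y$ is of pointwise countable type if every point of $Y$ lies in a compact set with countable character. The density of $X$ is $d(X)=\aleph_0+\min\{|D|: D \text{ dense in } X\}$; $X$ is $\aleph_\alpha$-separable if $d(X)<\aleph_\alpha$. $C(X)$ is the set of all real-valued continuous functions on $X$. For $f\in C(X)$, $A\subseteq X$ with $|A|<\aleph_\alpha$ and real $\epsilon>0$ put $B(f,A,\epsilon)=\{g\in C(X): \sup_{x\in A}|f(x)-g(x)|<\epsilon\}$ (equal to $C(X)$ when $A=\emptyset$). These sets form a base of a topology on $C(X)$; $C_{\aleph_\alpha}(X)$ denotes $C(X)$ with this topology. *)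

(* Defs.v *)
From HB Require Import structures.
From mathcomp Require Import all_boot all_order all_algebra.
From mathcomp Require Import all_classical all_reals all_analysis.
From mathcomp Require Import borel_hierarchy.

Set Implicit Arguments.
Unset Strict Implicit.
Unset Printing Implicit Defensive.

Import Order.TTheory GRing.Theory Num.Theory.
Import numFieldNormedType.Exports.

Local Open Scope classical_set_scope.
Local Open Scope ring_scope.
Local Open Scope card_scope.

Definition card_lt (T U : Type) (A : set T) (B : set U) : Prop :=
  (A #<= B) /\ ~ (B #<= A).

Definition tychonoff_space (Y : topologicalType) : Prop :=
  completely_regular_space Y /\ hausdorff_space Y.

Definition open_map (Y Z : topologicalType) (f : Y -> Z) : Prop :=
  forall U : set Y, open U -> open (f @` U).

Definition surjective (T U : Type) (f : T -> U) : Prop :=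
  forall u, exists t, f t = u.

Definition homeomorphism (Y Z : topologicalType) (f : Y -> Z) : Prop :=
  [/\ bijective f, continuous f & open_map f].

(** The Stone-Cech compactification of [Y]: the closure of the image of [Y]
    under the evaluation map into the product [0, 1]^C(Y, [0, 1]). The factors
    are written as [R], which does not change the closure, because the image
    lies in the closed subset [0, 1]^C(Y, [0, 1]). *)
Section StoneCech.
Context (R : realType) (Y : topologicalType).

Definition unit_functions : set (Y -> R) :=
  [set f : Y -> R | continuous f /\ forall y, 0 <= f y <= 1].

Definition stone_cech_cube : topologicalType :=
  prod_topology (fun _ : set_type unit_functions => R : topologicalType).

Definition stone_cech_eval (y : Y) : stone_cech_cube :=
  fun f => set_val f y.

Definition stone_cech : topologicalType :=
  set_type (closure (range stone_cech_eval)).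

Lemma stone_cech_eval_closure (y : Y) :
  stone_cech_eval y \in closure (range stone_cech_eval).
Proof. by apply/mem_set/subset_closure; exists y. Qed.

Definition stone_cech_embed (y : Y) : stone_cech :=
  exist _ (stone_cech_eval y) (stone_cech_eval_closure y).

Definition cech_complete : Prop :=
  tychonoff_space Y /\ Gdelta (range stone_cech_embed).

End StoneCech.

Definition locally_cech_complete (R : realType) (Y : topologicalType) : Prop :=
  tychonoff_space Y /\
  forall y : Y, exists2 N : set Y, nbhs y N & cech_complete R (set_type N).

Definition completely_metrizable (R : realType) (Y : topologicalType) : Prop :=
  exists (M : metricType R) (h : Y -> M),
    homeomorphism h /\
    forall u : nat -> M, cauchy (u @ \oo) -> exists l : M, u @ \oo --> l.

Definition open_cover (Y : topologicalType) (C : set (set Y)) : Prop :=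
  (forall U, C U -> open U) /\ \bigcup_(U in C) U = [set: Y].

Definition refines (Y : Type) (D C : set (set Y)) : Prop :=
  forall V, D V -> exists2 U, C U & V `<=` U.

Definition locally_finite (Y : topologicalType) (D : set (set Y)) : Prop :=
  forall y : Y, exists2 N : set Y,
    nbhs y N & finite_set [set V | D V /\ V `&` N !=set0].

Definition paracompact (Y : topologicalType) : Prop :=
  hausdorff_space Y /\
  forall C : set (set Y), open_cover C ->
    exists D : set (set Y), [/\ open_cover D, refines D C & locally_finite D].

Definition open_continuous_image (Z Y : topologicalType) : Prop :=
  exists f : Z -> Y, [/\ continuous f, open_map f & surjective f].

Definition countable_character (Y : topologicalType) (S : set Y) : Prop :=
  exists W : nat -> set Y,
    (forall n, open (W n) /\ S `<=` W n) /\
    forall U : set Y, open U -> S `<=` U -> exists n, W n `<=` U.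

Definition pointwise_countable_type (Y : topologicalType) : Prop :=
  forall y : Y, exists S : set Y, [/\ S y, compact S & countable_character S].

Definition min_dense (X : topologicalType) (D : set X) : Prop :=
  dense D /\ forall D' : set X, dense D' -> D #<= D'.

(** A cardinal is represented by a type [kappa] of that cardinality. The
    disjoint sum [nat + D], for [D] a dense set of least cardinality, represents
    the density aleph_0 + min |D|. *)
Definition aleph_separable (kappa : Type) (X : topologicalType) : Prop :=
  exists D : set X,
    min_dense D /\ card_lt [set: (nat + set_type D)%type] [set: kappa].

(** [Caleph R kappa X] is the set of continuous functions [X -> R] with the
    topology generated by the sets [C_ball f A e], |A| < kappa, 0 < e. For
    infinite [kappa] these sets form a base, so the topology they generate as a
    subbase is the one having them as a base. *)
Definition Caleph (R : realType) (kappa : Type) (X : topologicalType) : Type :=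
  continuousType X R.

Section CalephTopology.
Context (R : realType) (kappa : Type) (X : topologicalType).

HB.instance Definition _ :=
  Choice.copy (Caleph R kappa X) (continuousType X R).

Definition Ceval (f : Caleph R kappa X) : X -> R :=
  (f : continuousType X R).

(** The supremum is taken in the extended reals: it may be [+oo], and it is
    [-oo] when [A] is empty, in which case [C_ball f A e] is everything. *)
Definition C_ball (f : Caleph R kappa X) (A : set X) (e : R) :
    set (Caleph R kappa X) :=
  [set g | (ereal_sup [set (`|Ceval f x - Ceval g x|)%:E | x in A] < e%:E)%E].

Definition C_balls : set (set (Caleph R kappa X)) :=
  [set B | exists (f : Caleph R kappa X) (A : set X) (e : R),
    [/\ card_lt A [set: kappa], 0 < e & B = C_ball f A e]].

HB.instance Definition _ :=
  isSubBaseTopological.Build (Caleph R kappa X) C_balls id.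

End CalephTopology.

(* Main.v *)
From HB Require Import structures.
Require Import Defs.
From mathcomp Require Import all_boot all_order all_algebra.
From mathcomp Require Import all_classical all_reals all_analysis.
From mathcomp Require Import wochoice.
From mathcomp Require Import finmap lra.


(** Suppose that $C_{\aleph_\alpha}(X)$ is of pointwise countable type, but that
    no set of cardinality less than $\aleph_\alpha$ is dense in X. Let S be a
    compact set containing 0 with a base $(W_n)$ of open neighborhoods. Each
    $W_n$ contains a ball $B(0, A_n, \epsilon_n)$ and $A_n$ is not dense, so
    $W_n$ contains functions $f_n$ vanishing on $A_n$ and arbitrarily large at a
    point $x_n$ outside the closure of $A_n$. Since S is bounded at each $x_n$,
    the $f_n$ can be chosen at uniform distance at least 1 from S on the
    countable set $\{x_n\}$, so no $W_n$ is contained in the union of the balls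
    $B(s, \{x_n\}, 1)$ for s in S. This works for every uncountable
    $\aleph_\alpha$, whatever its cofinality.

    Conversely, if D is dense with $|D| < \aleph_\alpha$, the topology is that of
    uniform convergence on D, hence on X, and the truncated sup metric is
    complete. A completely metrizable space is Cech-complete, and paracompact by
    Stone's theorem, so it is its own image in (4) and (5). A locally
    Cech-complete space is of pointwise countable type, because in the
    Stone-Cech compactification a point of a G_delta set lies in a compact
    G_delta set contained in it, and this property passes to open continuous
    images. *)

Set Implicit Arguments.
Unset Strict Implicit.
Unset Printing Implicit Defensive.

Import Order.TTheory GRing.Theory Num.Theory.
Import numFieldNormedType.Exports.

Local Open Scope classical_set_scope.
Local Open Scope ring_scope.

(** * Cardinals *)

#[local] Open Scope card_scope.

Lemma card_le_inj (T U : Type) (A : set T) (B : set U) (f : T -> U) :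
  set_fun A B f -> {in A &, injective f} -> A #<= B.
Proof.
move=> fAB finj; rewrite -(card_le_eql (inj_card_eq finj)).
by apply: subset_card_le => _ [x Ax <-]; exact: fAB.
Qed.

Lemma card_leT_inj (T U : Type) (f : T -> U) :
  injective f -> [set: T] #<= [set: U].
Proof. by move=> finj; apply: (@card_le_inj _ _ _ _ f) => // x y _ _ /finj. Qed.

Lemma card_le_injP (T U : Type) (A : set T) (B : set U) :
  A #<= B -> exists f : set_type A -> set_type B, injective f.
Proof.
move=> /card_leP[f]; exists f => x y fxy.
by apply: (@inj _ _ setT f) => //; exact: in_setT.
Qed.

(* A maximal set of choice functions all of whose coordinates are injective
   must have a surjective coordinate. *)
Lemma exists_least_type (I : Type) (i0 : I) (T : I -> Type) :
  exists i, forall j, exists f : T i -> T j, injective f.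
Proof.
pose P := [set S : set (forall i, T i) |
  forall i s t, S s -> S t -> s i = t i -> s = t].
have [|S [PS maxS]] := @Zorn_bigcup _ P.
  move=> F FP Ftot i s t [A FA As] [B FB Bt].
  by case: (Ftot _ _ FA FB) => AB;
    [apply: (FP _ FB) => //; exact: AB|apply: (FP _ FA) => //; exact: AB].
have [i Si] : exists i, forall y : T i, exists2 s, S s & s i = y.
  apply: contrapT => /forallNP nS.
  have {}nS i : exists y, ~ exists2 s, S s & s i = y by exact/existsNP.
  (* If no coordinate is onto, choosing a missed value in each gives a function that could be added
     to [S]. *)
  pose x i := sval (cid (nS i)); have xS i := svalP (cid (nS i)).
  apply: (maxS (S `|` [set x])).
    split; first by move=> s; left.
    by move=> /(_ x (or_intror erefl)) Sx; apply: (xS i0); exists x.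
  move=> i s t [Ss|->] [St|->] // st; first exact: (PS i).
  - by exfalso; apply: (xS i); exists s.
  - by exfalso; apply: (xS i); exists t.
exists i => j.
have /choice[g gS] : forall y : T i, exists s, S s /\ s i = y.
  by move=> y; have [s Ss sy] := Si y; exists s.
exists (fun y => g y j) => y z gyz.
rewrite -(gS y).2 -(gS z).2; congr (_ i).
by apply: (PS j) => //; [exact: (gS y).1|exact: (gS z).1].
Qed.

Lemma card_le_total (T U : Type) (A : set T) (B : set U) :
  A #<= B \/ B #<= A.
Proof.
have [b H] := exists_least_type true (fun b : bool => if b then A : Type else B).
rewrite -(card_le_eql (card_setT A)) -(card_le_eqr (card_setT B)).
rewrite -(card_le_eql (card_setT B)) -(card_le_eqr (card_setT A)).
case: b H => H.
- by left; have [f /card_leT_inj] := H false.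
- by right; have [f /card_leT_inj] := H true.
Qed.

(* Up to a finite remainder, an infinite type is a disjoint union of
   sequences. *)
Lemma infinite_double (T : Type) : infinite_set [set: T] ->
  exists f : T * bool -> T, injective f.
Proof.
move=> Tinf.
(* Families of injective sequences with pairwise disjoint ranges; [Q] below collects the points that
   a maximal one misses. *)
pose P := [set F : set (nat -> T) |
  forall s t m n, F s -> F t -> s m = t n -> s = t /\ m = n].
have [|F [PF maxF]] := @Zorn_bigcup _ P.
  move=> G GP Gtot s t m n [A GA As] [B GB Bt].
  by case: (Gtot _ _ GA GB) => AB;
    [apply: (GP _ GB) => //; exact: AB|apply: (GP _ GA) => //; exact: AB].
pose Q := [set x | forall s n, F s -> s n <> x].
have Qfin : finite_set Q.
  apply/finite_setPn => /card_le_injP[nu nuinj].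
  pose u n : T := val (nu (exist _ n (mem_set I))).
  have uinj : injective u.
    by move=> m n /val_inj/nuinj/(congr1 val).
  have Qu n : Q (u n) by exact: set_mem (valP (nu _)).
  apply: (maxF (F `|` [set u])).
    split; first by move=> s; left.
    move=> /(_ u (or_intror erefl)) Fu; exact: (Qu 0%N u 0%N).
  move=> s t m n [Fs|->] [Ft|->] st; first exact: PF st.
  - by exfalso; exact: (Qu n s m Fs).
  - by exfalso; exact: (Qu m t n Ft).
  - by split=> //; exact: uinj.
have [s0 Fs0] : exists s, F s.
  apply: contrapT => /forallNP nF; apply: Tinf.
  by apply: sub_finite_set Qfin => x _ s n /nF.
have [i iinj] : exists i : T -> nat, {in Q &, injective i}.
  exact/countable_injP/finite_set_countable.
(* [c x] is a sequence with a position: a covered point gets twice its index, a point of [Q] an odd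
   position on [s0], so [c] is injective. *)
have /choice[c cP] : forall x, exists p : (nat -> T) * nat, F p.1 /\
    ((exists2 n, p.2 = n.*2 & p.1 n = x) \/
     [/\ Q x, p.1 = s0 & p.2 = (i x).*2.+1]).
  move=> x; have [Qx|/existsNP[s /existsNP[n]]] := pselect (Q x).
    by exists (s0, (i x).*2.+1); split=> //; right.
  move=> /not_implyP[Fs /contrapT sx].
  by exists (s, n.*2); split=> //; left; exists n.
have cinj : injective c.
  move=> x y cxy; have [_] := cP x; have [_] := cP y; rewrite -cxy.
  case=> [[n -> ny]|[Qy _ ->]] [[m]|[Qx _]].
  - by move=> /double_inj nm <-; rewrite -ny nm.
  - by move=> /(congr1 odd); rewrite /= !odd_double.
  - by move=> /(congr1 odd); rewrite /= !odd_double.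
  - by move=> [/double_inj/esym ixy]; apply: iinj ixy; exact: mem_set.
(* Doubling the position leaves room for the boolean, which parity recovers. *)
exists (fun p : T * bool => (c p.1).1 ((c p.1).2.*2 + p.2)%N) 
  => -[x a] [y b] /= e.
have [e1 e2] := PF _ _ _ _ (cP x).1 (cP y).1 e.
have ab : a = b.
  by move: (congr1 odd e2); rewrite !oddD !odd_double /= !oddb.
congr pair => //; apply: cinj.
move: e2; rewrite ab => /addIn/double_inj e2.
by rewrite [c x]surjective_pairing [c y]surjective_pairing e1 e2.
Qed.

Lemma card_le_lt_trans (T U V : Type) (A : set T) (B : set U) (K : set V) :
  A #<= B -> card_lt B K -> card_lt A K.
Proof.
move=> AB [BK nKB]; split; first exact: card_le_trans AB BK.
by move=> KA; apply: nKB; exact: card_le_trans KA AB.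
Qed.

Lemma card_nltP (T U : Type) (A : set T) (K : set U) :
  ~ card_lt A K -> K #<= A.
Proof.
by have [AK|//] := card_le_total A K => nAK; apply: contrapT => ?; apply: nAK.
Qed.

Lemma countable_card_lt (T U : Type) (A : set T) (K : set U) :
  countable A -> ~ countable K -> card_lt A K.
Proof.
move=> cA ncK; apply: contrapT => /card_nltP KA; apply: ncK.
exact: card_le_trans KA cA.
Qed.

(** If the larger set is finite, so is the union. Otherwise the union injects into two copies of the
    larger set, hence into that set by doubling. *)
Lemma card_lt_setU (T U : Type) (A B : set T) (K : set U) :
  ~ countable K -> card_lt A K -> card_lt B K -> card_lt (A `|` B) K.
Proof.
move=> ncK; wlog AB : A B / A #<= B.
  move=> wl AK BK; have [AB|BA] := card_le_total A B; first exact: wl.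
  by rewrite setUC; exact: wl.
move=> AK BK; have [Bfin|Binf] := pselect (finite_set B).
  apply: countable_card_lt => //; apply: finite_set_countable.
  by rewrite finite_setU; split=> //; exact: card_le_finite AB Bfin.
apply: card_le_lt_trans BK.
have [f finj] : exists f : set_type B * bool -> set_type B, injective f.
  by apply: infinite_double; rewrite (eq_finite_set (card_setT B)).
have [g ginj] := card_le_injP AB.
rewrite -(card_le_eql (card_setT _)) -(card_le_eqr (card_setT _)).
have /choice[h hP] : forall x : set_type (A `|` B), exists p : set_type B * bool,
    if p.2 then exists2 a, g a = p.1 & val a = val x else val p.1 = val x.
  move=> [x /= /set_mem[]] xAB.
    by exists (g (exist _ x (mem_set xAB)), true);
       exists (exist _ x (mem_set xAB)).
  by exists (exist _ x (mem_set xAB), false).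
apply: (@card_leT_inj _ _ (f \o h)) => x y /finj hxy.
have := hP x; have := hP y; rewrite -hxy; case: ifP => _.
- move=> [a <- ay] [b gb bx]; apply: val_inj; rewrite -ay -bx.
  by rewrite (ginj _ _ gb).
- by move=> yE xE; apply: val_inj; rewrite -xE -yE.
Qed.

(** The dense sets form a family of types, inhabited by the whole space, and such a family has a
    least member. *)
Lemma min_dense_exists (X : topologicalType) : exists D : set X, min_dense D.
Proof.
have dT : dense [set: X] by move=> O [x Ox] _; exists x.
pose I := {D : set X | dense D}.
have [[D dD] DP] := @exists_least_type I (exist _ setT dT)
  (fun i => set_type (proj1_sig i)).
exists D; split=> // D' dD'.
have [f /card_leT_inj] := DP (exist _ D' dD').
by rewrite (card_le_eql (card_setT _)) (card_le_eqr (card_setT _)).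
Qed.

Lemma aleph_separableP (kappa : Type) (X : topologicalType) :
  ~ countable [set: kappa] ->
  aleph_separable kappa X <->
  exists2 A : set X, dense A & card_lt A [set: kappa].
Proof.
move=> nck; split=> [[D [[dD _] Dk]]|[A dA Ak]].
  exists D => //; apply: card_le_lt_trans Dk.
  rewrite -(card_le_eql (card_setT _)); apply: (@card_leT_inj _ _ inr).
  by move=> x y [].
have [D Dmin] := min_dense_exists X; exists D; split=> //.
have -> : [set: nat + D] = range inl `|` range inr.
  by apply/seteqP; split=> // -[n|x] _; [left; exists n|right; exists x].
apply: card_lt_setU => //.
  apply: countable_card_lt => //.
  exact: card_le_trans (card_image_le _ _) (card_lexx _).
apply: card_le_lt_trans Ak; apply: card_le_trans (card_image_le _ _) _.
by rewrite (card_le_eql (card_setT _)); exact: Dmin.2.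
Qed.

#[local] Close Scope card_scope.

(** * From pointwise countable type to separability *)

Lemma C_ballP (R : realType) (kappa : Type) (X : topologicalType)
    (f g : Caleph R kappa X) (A : set X) (e : R) :
  C_ball f A e g <->
  exists2 r, r < e & forall x, A x -> `|Ceval f x - Ceval g x| <= r.
Proof.
rewrite /C_ball /=; set S := [set _ | _ in A]; split.
  have ub x : A x -> ((`|Ceval f x - Ceval g x|)%:E <= ereal_sup S)%E.
    by move=> Ax; apply: ereal_sup_ubound; exists x.
  case: (ereal_sup S) ub => [r| |] ub //=.
    by rewrite lte_fin => re; exists r => // x /ub; rewrite lee_fin.
  (* Here the supremum is [-oo], so [A] is empty and any real below [e] serves. *)
  by move=> _; exists (e - 1); [rewrite ltrBlDr ltrDl|move=> x /ub].
move=> [r re fg]; apply: (@le_lt_trans _ _ r%:E); last by rewrite lte_fin.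
by apply: ge_ereal_sup => _ [x Ax <-]; rewrite lee_fin; exact: fg.
Qed.

Lemma C_ball_center (R : realType) (kappa : Type) (X : topologicalType)
    (f : Caleph R kappa X) (A : set X) (e : R) : 0 < e -> C_ball f A e f.
Proof. by move=> e0; apply/C_ballP; exists 0 => // x _; rewrite subrr normr0. Qed.

Lemma open_C_ball (R : realType) (kappa : Type) (X : topologicalType)
    (f : Caleph R kappa X) (A : set X) (e : R) :
  card_lt A [set: kappa] -> 0 < e -> open (C_ball f A e).
Proof.
move=> Ak e0; exists [set C_ball f A e]; last by rewrite bigcup_set1.
move=> _ ->; exists [fset C_ball f A e]%fset.
  by move=> B; rewrite !inE => /eqP ->; apply/mem_set; exists f, A, e.
apply/seteqP; split=> [g /(_ (C_ball f A e))|g fg B] /=;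
  [by apply; rewrite inE|by rewrite inE => /eqP ->].
Qed.

(** Finitely many subbasic balls around other centers contain a common ball around [f]: the union of
    their index sets stays below an uncountable [kappa], and the radius is the least slack. *)
Lemma nbhs_C_ball (R : realType) (kappa : Type) (X : topologicalType)
    (f : Caleph R kappa X) (U : set (Caleph R kappa X)) :
  ~ countable [set: kappa] ->
  nbhs f U <->
  exists A (e : R), [/\ card_lt A [set: kappa], 0 < e & C_ball f A e `<=` U].
Proof.
move=> nck; split; last first.
  move=> [A [e [Ak e0]]] /filterS; apply; apply: open_nbhs_nbhs.
  by split; [exact: open_C_ball|exact: C_ball_center].
rewrite nbhsE => -[_ [[D' D'C <-]] [B D'B Bf] BU].
have [F FC FB] := D'C _ D'B.
suff [A [e [Ak e0 AF]]] : exists A (e : R), [/\ card_lt A [set: kappa], 0 < e &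
    forall B, B \in (F : seq _) -> C_ball f A e `<=` B].
  exists A, e; split=> // g Ag; apply: BU; eexists; first exact: D'B.
  have gF C : C \in F -> C g by move=> CF; exact: (AF C CF g Ag).
  by rewrite -FB; exact: gF.
have {}Bf C : C \in F -> C f by move: C; rewrite -FB in Bf; exact: Bf.
have {}FC C : C \in F -> C_balls C by move=> /FC /set_mem.
have {}Bf C : C \in (F : seq _) -> C f by exact: Bf.
have {}FC C : C \in (F : seq _) -> C_balls C by exact: FC.
elim: (F : seq _) FC Bf => {D'B BU FB B} [|B s IH] FC Bf.
  by exists set0, 1; split=> //; exact: countable_card_lt.
have [||A [e [Ak e0 As]]] := IH.
- by move=> C Cs; apply: FC; rewrite inE Cs orbT.
- by move=> C Cs; apply: Bf; rewrite inE Cs orbT.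
have Bin : B \in B :: s by exact: mem_head.
have [h [A' [e' [A'k e'0 Bh]]]] :
  exists (f : Caleph R kappa X) (A : set X) (e : R),
    [/\ card_lt A [set: kappa], 0 < e & B = C_ball f A e] by exact: FC.
have /C_ballP[r re' hfr] : C_ball h A' e' f by rewrite -Bh; exact: Bf.
exists (A `|` A'), (Num.min e (e' - r)); split.
- exact: card_lt_setU.
- by rewrite lt_min e0 subr_gt0.
- move=> C; rewrite inE => /orP[/eqP -> {C}|/As] g.
    move=> /C_ballP[t]; rewrite lt_min => /andP[_ te] fg.
    rewrite Bh; apply/C_ballP; exists (r + t); first by rewrite -ltrBrDl.
    move=> x A'x; apply: le_trans (ler_distD (Ceval f x) _ _) _.
    by apply: lerD; [exact: hfr|apply: fg; right].
  apply: subset_trans g => g /C_ballP[t]; rewrite lt_min => /andP[te _] fg.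
  by apply/C_ballP; exists t => // x Ax; apply: fg; left.
Qed.

Definition C_of (R : realType) (kappa : Type) (X : topologicalType)
  (f : X -> R) (cf : continuous f) : Caleph R kappa X := mkcts cf.

Lemma Ceval_C_of (R : realType) (kappa : Type) (X : topologicalType)
  (f : X -> R) (cf : continuous f) : Ceval (C_of kappa cf) = f.
Proof. by []. Qed.

Lemma Ceval_continuous (R : realType) (kappa : Type) (X : topologicalType)
    (x : X) : ~ countable [set: kappa] ->
  continuous (fun f : Caleph R kappa X => Ceval f x).
Proof.
move=> nck f; have FF : Filter (nbhs f) by exact: nbhs_filter.
apply/cvgrPdist_lt => e e0.
apply/(nbhs_C_ball _ _ nck); exists [set x], e; split=> //.
  by apply: countable_card_lt.
by move=> g /C_ballP[r re fg]; exact: le_lt_trans (fg x erefl) re.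
Qed.

Lemma not_denseP (X : topologicalType) (A : set X) :
  ~ dense A -> exists x, ~ closure A x.
Proof.
move=> dA; apply: contrapT => /forallNP Acl; apply: dA => O [x Ox] oO.
have /contrapT/(_ O) := Acl x.
by rewrite setIC; apply; apply: open_nbhs_nbhs.
Qed.

Lemma compact_Ceval_bounded (R : realType) (kappa : Type) (X : topologicalType)
    (S : set (Caleph R kappa X)) (x : X) : ~ countable [set: kappa] ->
  compact S -> exists M, forall f, S f -> `|Ceval f x| <= M.
Proof.
move=> nck cS.
have /compact_bounded[M [_ MS]] : compact ((fun f => Ceval f x) @` S).
  apply: continuous_compact cS; apply: continuous_subspaceT.
  exact: Ceval_continuous.
by exists (M + 1) => f Sf; apply: (MS (M + 1)); [rewrite ltrDl|exists f].
Qed.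

Lemma pointwise_countable_type_separable (R : realType) (kappa : Type)
    (X : topologicalType) :
  ~ countable [set: kappa] -> tychonoff_space X ->
  pointwise_countable_type (Caleph R kappa X) -> aleph_separable kappa X.
Proof.
move=> nck [crX _] pct; apply/(aleph_separableP _ nck); apply: contrapT => nA.
pose f0 : Caleph R kappa X := C_of kappa (@cst_continuous X R 0).
have [S [Sf0 cS [W [oW WS]]]] := pct f0.
have /choice[A AP] n : exists A, card_lt A [set: kappa] /\
    exists2 e : R, 0 < e & C_ball f0 A e `<=` W n.
  have /(nbhs_C_ball _ _ nck)[A [e [Ak e0 AW]]] : nbhs f0 (W n).
    by apply: open_nbhs_nbhs; split; [exact: (oW n).1|exact: (oW n).2].
  by exists A; split=> //; exists e.
have /choice[x xA] n : exists x, ~ closure (A n) x.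
  by apply: not_denseP => dA; apply: nA; exists (A n) => //; exact: (AP n).1.
have /choice[M MS] n := @compact_Ceval_bounded R kappa X S (x n) nck cS.
have /choice[f fP] n : exists f, W n f /\ Ceval f (x n) = M n + 1.
  have /(@uniform_separatorP _ R)[u [cu _ ux uA]] :=
    crX (x n) _ (@closed_closure _ (A n)) (xA n).
  have {}ux : u (x n) = 0 by apply: ux; exists (x n).
  have {}uA y : A n y -> u y = 1.
    by move=> Ay; apply: uA; exists y => //; exact: subset_closure.
  (* Scaling [1 - u] gives a function that vanishes on [A n], hence lies in [W n], but exceeds every
     member of [S] by at least 1 at [x n]. *)
  have cf : continuous (fun y => (M n + 1) * (1 - u y)).
    move=> y; apply: cvgM; first exact: cvg_cst.
    by apply: cvgB; [exact: cvg_cst|exact: cu].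
  exists (C_of kappa cf); split.
    have [_ [e e0]] := AP n; apply; apply/C_ballP; exists 0 => // y Ay.
    have -> : Ceval (C_of kappa cf) y = 0.
      by rewrite Ceval_C_of uA// subrr mulr0.
    by rewrite subrr normr0.
  by rewrite Ceval_C_of ux subr0 mulr1.
have xk : card_lt (range x) [set: kappa].
  apply: countable_card_lt => //.
  exact: card_le_trans (card_image_le _ _) (card_lexx _).
(* As [range x] is countable, these balls are open; a [W n] inside their union would put [f n] at
   distance less than 1 from some [s] in [S] at [x n]. *)
have [||n Wn] := WS (\bigcup_(s in S) C_ball s (range x) 1).
- by apply: bigcup_open => s _; exact: open_C_ball.
- by move=> s Ss; exists s => //; exact: C_ball_center.
have [s Ss /C_ballP[r r1 /(_ (x n))]] := Wn _ (fP n).1.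
rewrite (fP n).2 => sr; have {}sr := sr (imageT x n).
have := MS n s Ss; rewrite leNgt => /negP; apply.
have := le_lt_trans sr r1; rewrite distrC => /(le_lt_trans (lerB_dist _ _)).
by have := ler_norm (M n + 1); lra.
Qed.

(** * Cech-complete spaces *)

Lemma stone_cech_cube_regular (R : realType) (Y : topologicalType) :
  @regular_space (stone_cech_cube R Y).
Proof.
exact: (@uniform_regular (prod_topology
  (fun _ : set_type (@unit_functions R Y) => R : uniformType))).
Qed.

Lemma stone_cech_proj_continuous (R : realType) (Y : topologicalType)
    (u : set_type (@unit_functions R Y)) :
  continuous (fun p : stone_cech_cube R Y => p u).
Proof. exact: (@proj_continuous _ (fun _ => R : topologicalType) u). Qed.

Lemma stone_cech_eval_continuous (R : realType) (Y : topologicalType) :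
  continuous (@stone_cech_eval R Y).
Proof.
move=> y; apply/cvg_sup => u.
have cu : continuous (set_val u : Y -> R) by have /set_mem[] := valP u.
move=> A [_ [[C oC <-] Cy CA]]; apply: filterS CA _.
by apply: (cu y); apply: open_nbhs_nbhs.
Qed.

(** The closure lies in a product of unit intervals, compact by Tychonoff's theorem and closed
    because the whole product is Hausdorff. *)
Lemma compact_stone_cech (R : realType) (Y : topologicalType) :
  compact (closure (range (@stone_cech_eval R Y))).
Proof.
pose I := [set p : stone_cech_cube R Y | forall u, `[0, 1]%classic (p u : R)].
have cI : compact I.
  apply: (@tychonoff _ (fun _ => R : topologicalType) (fun _ => `[0, 1]%classic)).
  by move=> u; exact: segment_compact.
apply: (subclosed_compact _ cI); first exact: closed_closure.
have clI : I = closure I.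
  apply/closure_id; apply: compact_closed cI.
  apply: (@hausdorff_product _ (fun _ => R : topologicalType)) => u.
  exact: norm_hausdorff.
rewrite clI; apply: closureS => _ [y _ <-] u.
by have /set_mem[_ /(_ y)] := valP u; rewrite /= in_itv.
Qed.

(** A function that is 0 at [y] and 1 off an open set inside [U] is a coordinate of the cube; [O]
    requires this coordinate to be less than 1. *)
Lemma stone_cech_eval_embedding (R : realType) (Y : topologicalType) (y : Y)
    (U : set Y) : tychonoff_space Y -> nbhs y U ->
  exists O : set (stone_cech_cube R Y), [/\ open O, O (@stone_cech_eval R Y y) &
    @stone_cech_eval R Y @^-1` O `<=` U].
Proof.
move=> [crY _]; rewrite nbhsE => -[B [oB By] BU].
have /(@uniform_separatorP _ R)[f [cf f01 fy fB]] :
  uniform_separator [set y] (~` B).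
  by apply: crY => //; exact: open_closedC.
have fu : unit_functions f.
  by split=> // z; have := f01 _ (imageT f z); rewrite /= in_itv.
pose u : set_type (@unit_functions R Y) := exist _ f (mem_set fu).
exists [set p | p u < 1]; split.
- have := @stone_cech_proj_continuous R Y u.
  by move/continuousP => /(_ _ (@open_lt R 1)).
- have fy0 : f y = 0 by apply: fy; exists y.
  by suff : f y < 1 by []; rewrite fy0 ltr01.
- move=> z /= fz; apply: BU; apply: contrapT => nBz.
  have : f z = 1 by apply: fB; exists z.
  by move=> fz1; have : f z < 1 by []; rewrite fz1 ltxx.
Qed.

(** Nested open sets [V n] of the cube, each closure lying in the previous set and in one more set
    of the G_delta, shrink to a compact [K] inside the image of [Y]; [S] and [W] are preimages.
    Starting inside [U] serves the local case. *)
Lemma cech_complete_countable_character (R : realType) (Y : topologicalType)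
    (y : Y) (U : set Y) : cech_complete R Y -> nbhs y U ->
  exists (S : set Y) (W : nat -> set Y), [/\ S y, compact S,
    forall n, [/\ open (W n), S `<=` W n & W n `<=` U] &
    forall O : set Y, open O -> S `<=` O -> exists n, W n `<=` O].
Proof.
move=> [tY [F oF FE]] yU; set ev := @stone_cech_eval R Y.
set K0 := closure (range ev).
have /choice[G GP] n : exists G, open G /\ F n = set_val @^-1` G.
  by have [G oG <-] := oF n; exists G.
have Gev n z : G n (ev z).
  have : range (@stone_cech_embed R Y) (stone_cech_embed R z) by exists z.
  by rewrite FE => /(_ n I); rewrite (GP n).2.
have GK0 p : K0 p -> (forall n, G n p) -> range ev p.
  move=> Kp Gp.
  have : (\bigcap_i F i) (exist _ p (mem_set Kp)).
    by move=> n _; rewrite (GP n).2; exact: Gp.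
  by rewrite -FE => -[z _ /(congr1 val) /= <-]; exists z.
have [P0 [oP0 P0y P0U]] := @stone_cech_eval_embedding R Y y U tY yU.
(* One shrinking step, by regularity, from a neighborhood and an index; [setT] is a default value
   for inadmissible pairs. *)
have /choice[sh shP] (q : set (stone_cech_cube R Y) * nat) :
    exists V : set (stone_cech_cube R Y), open q.1 -> q.1 (ev y) ->
      [/\ open V, V (ev y) & closure V `<=` q.1 `&` G q.2].
  have [[oq qy]|nq] := pselect (open q.1 /\ q.1 (ev y)); last first.
    by exists setT => ? ?; exfalso; apply: nq.
  have : nbhs (ev y) (q.1 `&` G q.2).
    by apply: open_nbhs_nbhs; split; [apply: openI => //; exact: (GP _).1|split].
  move=> /stone_cech_cube_regular[V yV clV]; exists V° => _ _; split => //.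
  - exact: open_interior.
  - by apply: subset_trans clV; apply: closureS; exact: interior_subset.
pose fix V (n : nat) : set (stone_cech_cube R Y) :=
  if n is m.+1 then sh (V m, m) else P0.
have VP n : open (V n) /\ V n (ev y).
  by elim: n => [//|n [oV Vy]] /=; have [] := shP (V n, n) oV Vy.
have VS n : closure (V n.+1) `<=` V n `&` G n.
  by have [oV Vy] := VP n; have [] := shP (V n, n) oV Vy.
have Vle m n : (m <= n)%N -> V n `<=` V m.
  elim: n => [|n IH]; first by rewrite leqn0 => /eqP ->.
  rewrite leq_eqVlt => /orP[/eqP ->//|/IH]; apply: subset_trans => p Vp.
  exact: (VS n p (subset_closure Vp)).1.
pose K := K0 `&` \bigcap_n closure (V n).
have KV n : K `<=` V n by move=> p [_ /(_ n.+1 I) /VS[]].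
have Kev : K `<=` range ev.
  by move=> p [Kp Vp]; apply: GK0 => // n; exact: (VS n p (Vp n.+1 I)).2.
have cK : compact K.
  apply: subclosed_compact (@compact_stone_cech R Y) _; last by move=> p [].
  apply: closedI; first exact: closed_closure.
  by apply: closed_bigI => n _; exact: closed_closure.
(* Otherwise points [p n] of [V n] outside [Q] cluster at a point of every closure, that is of [K],
   although [Q] is a neighborhood of it free of all [p n]. *)
have Kbase (Q : set (stone_cech_cube R Y)) : open Q -> K `<=` Q ->
    exists n, K0 `&` V n `<=` Q.
  move=> oQ KQ; apply: contrapT => /forallNP nQ.
  have /choice[p pP] n : exists p, [/\ K0 p, V n p & ~ Q p].
    have /existsNP[p /not_implyP[[Kp Vp] nQp]] := nQ n; by exists p.
  have [|q [K0q clq]] := @compact_stone_cech R Y (p @ \oo) _.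
    by exists 0%N => // n _ /=; have [] := pP n.
  have qcl n : closure (V n) q.
    move=> B /clq; apply; exists n => // m nm /=.
    by apply: (Vle n m nm); have [] := pP m.
  have Qq : Q q by apply: KQ; split=> // n _.
  have [|z [nQz Qz]] := clq (~` Q) Q _ (open_nbhs_nbhs (conj oQ Qq)).
    by exists 0%N => // n _ /=; have [] := pP n.
  exact: nQz.
have evc : continuous ev by exact: stone_cech_eval_continuous.
exists (ev @^-1` K), (fun n => ev @^-1` V n); split.
- split; first by apply: subset_closure; exists y.
  by move=> n _; apply: subset_closure; exact: (VP n).2.
(* The image filter clusters in [K], whose points come from [Y], and the embedding pulls the cluster
   point back. *)
- move=> H PH HK; have [|q [Kq clz]] := cK (ev @ H) _; first exact: HK.
  have [z _ zq] := Kev _ Kq; rewrite -zq in Kq clz.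
  exists z; split=> // A B HA zB.
  have [Q [oQ Qz QB]] := @stone_cech_eval_embedding R Y z B tY zB.
  have [|b [[a Aa ab] Qb]] := clz (ev @` A) Q _ (open_nbhs_nbhs (conj oQ Qz)).
    by apply: (@filterS _ H _ A) => // a Aa; exists a.
  by exists a; rewrite -ab in Qb; split=> //; exact: QB.
- move=> n; split.
  + by move/continuousP : evc; apply; exact: (VP n).1.
  + by move=> z; exact: KV.
  + by move=> z Vz; apply: P0U; exact: (Vle 0%N n (leq0n n) _ Vz).
- move=> Q oQ KQ.
  (* The largest open set of the cube whose preimage in [Y] lies in [Q]. *)
  pose Q' := \bigcup_(P in [set P | open P /\ ev @^-1` P `<=` Q]) P.
  have [||n nQ'] := Kbase Q'.
  + by apply: bigcup_open => P [].
  + move=> p Kp; have [z _ zp] := Kev _ Kp.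
    have [P [oP Pz PQ]] := @stone_cech_eval_embedding R Y z Q tY
      (open_nbhs_nbhs (conj oQ (KQ z (eq_ind_r K Kp zp)))).
    by exists P => //; rewrite -zp.
  + exists n => z Vz; have [|P [_ PQ] Pz] := nQ' (ev z); last exact: PQ.
    by split=> //; apply: subset_closure; exists z.
Qed.

Lemma locally_cech_complete_pointwise_countable_type (R : realType)
    (Y : topologicalType) :
  locally_cech_complete R Y -> pointwise_countable_type Y.
Proof.
move=> [_ lY] y; have [N yN cN] := lY y.
have Ny : N y by exact: nbhs_singleton.
pose y' : set_type N := exist _ y (mem_set Ny).
have vc : continuous (set_val : set_type N -> Y) by exact: initial_continuous.
have yN' : nbhs y' (set_val @^-1` N°).
  by apply: (vc y'); apply: open_nbhs_nbhs; split=> //; exact: open_interior.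
have [S [W [Sy cS WP Wbase]]] := cech_complete_countable_character cN yN'.
exists (set_val @` S); split.
- by exists y'.
- by apply: continuous_compact cS; exact: continuous_subspaceT.
exists (fun n => set_val @` W n); split=> [n|O oO SO].
  have [oW SW WN] := WP n; split; last exact: image_subset.
  have [Q oQ QW] := oW.
  (* As [W n] stays in the interior of [N], openness in the subspace becomes openness in [Y]. *)
  suff -> : set_val @` W n = Q `&` N°.
    by apply: openI => //; exact: open_interior.
  apply/seteqP; split=> [_ [z Wz <-]|z [Qz Nz]].
    by split; [move: Wz; rewrite -QW|exact: WN].
  exists (exist _ z (mem_set (interior_subset Nz))) => //.
  by rewrite -QW.
have [||n WO] := Wbase (set_val @^-1` O).
- by move/continuousP : vc; apply.
- by move=> s Ss; apply: SO; exists s.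
- by exists n => _ [z /WO Oz <-].
Qed.

Lemma cech_complete_pointwise_countable_type (R : realType)
    (Y : topologicalType) :
  cech_complete R Y -> pointwise_countable_type Y.
Proof.
move=> cY y.
have [S [W [Sy cS WP Wbase]]] :=
  cech_complete_countable_character cY (@filterT _ (nbhs y) _).
by exists S; split=> //; exists W; split=> // n; have [] := WP n.
Qed.

Lemma open_continuous_image_pointwise_countable_type (Z Y : topologicalType) :
  open_continuous_image Z Y -> pointwise_countable_type Z ->
  pointwise_countable_type Y.
Proof.
move=> [f [cf of_ sf]] pZ y; have [z <-] := sf y.
have [S [Sz cS [W [WP Wbase]]]] := pZ z.
exists (f @` S); split.
- by exists z.
- by apply: continuous_compact cS; exact: continuous_subspaceT.
exists (fun n => f @` W n); split=> [n|O oO SO].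
  by have [oW SW] := WP n; split; [exact: of_|exact: image_subset].
have [||n WO] := Wbase (f @^-1` O).
- by move/continuousP : cf; apply.
- by move=> s Ss; apply: SO; exists s.
- by exists n => _ [x /WO Ox <-].
Qed.

(** * Complete metrics *)

(** The metric is a bare function compatible with the given topology of [Y], so that no
    homeomorphism has to be carried along. *)
Record complete_metric_on (R : realType) (Y : topologicalType)
    (d : Y -> Y -> R) : Prop := CompleteMetricOn {
  cm_xx : forall x, d x x = 0;
  cm_eq : forall x y, d x y = 0 -> x = y;
  cm_sym : forall x y, d x y = d y x;
  cm_triangle : forall y x z, d x z <= d x y + d y z;
  cm_nbhs : forall y A, nbhs y A <->
    exists2 e : R, 0 < e & [set z | d y z < e] `<=` A;
  cm_complete : forall u : nat -> Y,
    (forall e, 0 < e -> exists N, forall m n, (N <= m)%N -> (N <= n)%N ->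
      d (u m) (u n) < e) ->
    exists l : Y, u @ \oo --> l }.

Section Metrized.
Context (R : realType) (Y : topologicalType) (d : Y -> Y -> R).
Context (cm : complete_metric_on d).

(** An alias tied to [cm], on which the metric structure does not clash with the topology of [Y]. *)
Definition metrized : Type := let _ := cm in Y.

HB.instance Definition _ := Choice.copy metrized Y.
HB.instance Definition _ := @isMetric.Build R metrized d (cm_xx cm) (cm_eq cm)
  (cm_sym cm) (cm_triangle cm).

End Metrized.

Section CompleteMetric.
Context (R : realType) (Y : topologicalType) (d : Y -> Y -> R).
Context (cm : complete_metric_on d).

Lemma cm_nbhs_ball y e : 0 < e -> nbhs y [set z | d y z < e].
Proof. by move=> e0; apply/(cm_nbhs cm); exists e. Qed.

Lemma cm_ge0 x y : 0 <= d x y.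
Proof.
have := cm_triangle cm y x x.
by rewrite (cm_xx cm) (cm_sym cm y x); lra.
Qed.

Lemma cm_dist_lipschitz a x y : `|d a x - d a y| <= d x y.
Proof.
rewrite ler_norml; have := cm_triangle cm x a y; have := cm_triangle cm y a x.
by rewrite (cm_sym cm y x) => ? ?; apply/andP; split; lra.
Qed.

Lemma cm_dist_continuous a : continuous (d a).
Proof.
move=> x; apply/cvgrPdist_lt => e e0.
apply: filterS (cm_nbhs_ball x e0) => y /=.
exact/le_lt_trans/cm_dist_lipschitz.
Qed.

Lemma complete_metric_completely_metrizable : completely_metrizable R Y.
Proof.
have nE (y : Y) A : nbhs (y : metrized cm) A <-> nbhs y A.
  split=> [/nbhs_ballP[e e0 eA]|/(cm_nbhs cm)[e e0 eA]].
    by apply/(cm_nbhs cm); exists e => // z dz; apply: eA; rewrite ballEmdist.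
  by apply/nbhs_ballP; exists e => // z; rewrite ballEmdist => dz; exact: eA.
pose M : metricType R := metrized cm.
exists M, (id : Y -> M); split.
  split; first by exists id.
    by move=> y A /nE.
  move=> U oU; rewrite image_id openE => y Uy; apply/nE.
  exact: open_nbhs_nbhs.
move=> u /cauchyP cu; have [e e0|l ul] := cm_complete cm (u := u).
  have [x [N _ xN]] := cu (e / 2) (divr_gt0 e0 (ltr0n _ 2)).
  exists N => m n Nm Nn.
  have : d x (u m) < e / 2 by have := xN m Nm; rewrite /= ballEmdist.
  have : d x (u n) < e / 2 by have := xN n Nn; rewrite /= ballEmdist.
  have := cm_triangle cm x (u m) (u n); rewrite (cm_sym cm (u m) x); lra.
by exists l => A /nE; exact: ul.
Qed.

Lemma complete_metric_tychonoff : tychonoff_space Y.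
Proof.
split.
  move=> a B clB nBa; apply/(@uniform_separatorP _ R).
  have : nbhs a (~` B) by apply: open_nbhs_nbhs; split=> //; exact: closed_openC.
  move=> /(cm_nbhs cm)[e e0 eB].
  exists (fun z => Num.min 1 (d a z / e)); split.
  - apply: (@min_fun_continuous _ Y R (cst 1) (fun z => d a z / e)) => z.
      exact: cvg_cst.
    by apply: cvgM; [exact: cm_dist_continuous|exact: cvg_cst].
  - move=> _ [z _ <-]; rewrite /= in_itv /= ge_min lexx /= le_min ler01 /=.
    by rewrite divr_ge0 ?cm_ge0// ltW.
  - by move=> _ [_ -> <-] /=; rewrite (cm_xx cm) mul0r min_r.
  - move=> _ [z Bz <-] /=; apply/min_idPl; rewrite ler_pdivlMr// mul1r leNgt.
    by apply/negP => /eB; apply.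
move=> x y xy; apply: (cm_eq cm); apply/eqP/negPn/negP => dn0.
have d0 : 0 < d x y / 2 by rewrite divr_gt0// lt_neqAle eq_sym dn0 cm_ge0.
have [z [/= xz yz]] := xy _ _ (cm_nbhs_ball x d0) (cm_nbhs_ball y d0).
by have := cm_triangle cm z x y; rewrite (cm_sym cm z y); lra.
Qed.

End CompleteMetric.

Lemma completely_metrizable_metric (R : realType) (Y : topologicalType) :
  completely_metrizable R Y -> exists d : Y -> Y -> R, complete_metric_on d.
Proof.
move=> [M [h [[[g hK gK] ch oh] cM]]].
have nE y A : nbhs y A <-> nbhs (h y) (h @` A).
  split=> [|hA].
    rewrite nbhsE => -[B [oB By] BA].
    apply: (@filterS _ _ _ (h @` B)); first exact: image_subset.
    apply: open_nbhs_nbhs.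
    by split; [exact: oh|exists y].
  apply: (@filterS _ (nbhs y) _ (h @^-1` (h @` A))); last exact: (ch y _ hA).
  by move=> z [x Ax /(can_inj hK) <-].
exists (fun x y => mdist (h x) (h y)); split.
- by move=> x; exact: mdistxx.
- by move=> x y /mdist_positivity/(can_inj hK).
- by move=> x y; exact: metric_sym.
- by move=> y x z; exact: metric_triangle.
- move=> y A; split=> [/nE/nbhs_ballP[e e0 eA]|[e e0 eA]].
    exists e => // z dz.
    by have [|x Ax /(can_inj hK) <-//] := eA (h z); rewrite ballEmdist.
  apply/nE/nbhs_ballP; exists e => // z; rewrite ballEmdist => dz.
  by exists (g z) => //; apply: eA; rewrite /= gK.
- move=> u uc; have [|l ul] := cM (h \o u).
    apply/cauchy_exP => e e0; have [N NP] := uc e e0.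
    exists (h (u N)); exists N => // n Nn /=; rewrite ballEmdist /=; exact: NP.
  exists (g l) => A /nE; rewrite gK => /ul.
  apply: (@filterS _ \oo) => n [x Ax /(can_inj hK) xu].
  by suff: A (u n) by []; rewrite -xu.
Qed.

(* A point of the Stone-Cech compactification having neighborhoods with traces
   of arbitrarily small diameter is the limit of a Cauchy sequence. *)
Lemma complete_metric_cech_complete (R : realType) (Y : topologicalType)
    (d : Y -> Y -> R) : complete_metric_on d -> cech_complete R Y.
Proof.
move=> cm; split; first exact: complete_metric_tychonoff cm.
have tY := complete_metric_tychonoff cm.
set ev := @stone_cech_eval R Y.
pose small (V : set (stone_cech_cube R Y)) (e : R) :=
  forall a b, V (ev a) -> V (ev b) -> d a b < e.
(* Every point of the image lies in all [G n], since small balls are traces of open sets; the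
   converse needs completeness. *)
pose G (n : nat) := \bigcup_(V in [set V | open V /\ small V n.+1%:R^-1]) V.
have oG n : open (G n) by apply: bigcup_open => V [].
exists (fun n => set_val @^-1` G n).
  move=> n; exists (G n) => //.
apply/seteqP; split=> [_ [y _ <-] n _|p Gp].
  have e0 : 0 < n.+1%:R^-1 / 2 :> R by rewrite divr_gt0// invr_gt0.
  have [V [oV Vy Vball]] :=
    @stone_cech_eval_embedding R Y y _ tY (cm_nbhs_ball cm y e0).
  exists V => //; split=> // a b /Vball /= ya /Vball /= yb.
  apply: le_lt_trans (cm_triangle cm y a b) _.
  by rewrite (cm_sym cm a y) [ltRHS]splitr ltrD.
have /choice[V VP] n : exists V, [/\ open V, small V n.+1%:R^-1 & V (val p)].
  by have [V [oV sV] Vp] := Gp n I; exists V.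
(* [U n] is the intersection of [V 0] to [V n]; points chosen in the traces of the [U n] form a
   Cauchy sequence. *)
pose fix U (n : nat) : set (stone_cech_cube R Y) :=
  if n is m.+1 then U m `&` V n else V 0%N.
have Vnbhs n : nbhs (val p) (V n).
  by have [oV _ Vp] := VP n; exact: open_nbhs_nbhs.
have Unbhs n : nbhs (val p) (U n).
  by elim: n => [|n IH] //=; apply: filterI.
have Ucl n B : nbhs (val p) B -> exists y, U n (ev y) /\ B (ev y).
  move=> pB; have /set_mem := valP p.
  move=> /(_ (U n `&` B) (filterI (Unbhs n) pB))[_ [[y _ <-] [Uy By]]].
  by exists y.
have /choice[u uP] n : exists y, U n (ev y).
  by have [y [Uy _]] := Ucl n setT filterT; exists y.
have UV n m : (n <= m)%N -> forall a, U m (ev a) -> V n (ev a).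
  elim: m => [|m IH]; first by rewrite leqn0 => /eqP ->.
  by rewrite leq_eqVlt => /orP[/eqP -> a [_ //]|/IH nm a [/nm]].
have cvg0 (e : R) : 0 < e -> exists N, N.+1%:R^-1 < e.
  move=> e0; exists (Num.truncn e^-1).
  by rewrite invf_plt ?posrE// truncnS_gt.
have [e /cvg0[N Ne]|y uy] := cm_complete cm (u := u).
  exists N => m n Nm Nn; have [_ sV _] := VP N.
  by apply: lt_trans Ne; apply: sV; [apply: (UV _ m)|apply: (UV _ n)].
(* That the limit [y] is mapped to [p] is checked on each coordinate [w]. *)
exists y => //; apply: val_inj; apply: functional_extensionality_dep => w /=.
set f : Y -> R := set_val w.
have cf : continuous f by have /set_mem[] := valP w.
suff : forall e, 0 < e -> `|f y - (val p : stone_cech_cube R Y) w| < e.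
  move=> fp; apply/eqP; rewrite -subr_eq0 -normr_le0.
  by apply/ler_addgt0Pl => e e0; rewrite addr0 ltW// fp.
move=> e e0; have e20 : 0 < e / 2 by rewrite divr_gt0.
have /(cm_nbhs cm)[r r0 rf] : nbhs y [set z | `|f y - f z| < e / 2].
  by have /cvgrPdist_lt := cf y; apply.
have r20 : 0 < r / 2 by rewrite divr_gt0.
have [N Nr] := cvg0 _ r20.
have [M _ Mu] := uy _ (cm_nbhs_ball cm y r20).
(* For this [n], every point of the trace of [U n] is within [r] of [y]; [z] is one whose value
   under [f] is close to the coordinate of [p]. *)
pose n := maxn N M.
have Bp : nbhs (val p) [set q : stone_cech_cube R Y |
    `|(val p : stone_cech_cube R Y) w - q w| < e / 2].
  have /cvgrPdist_lt := @stone_cech_proj_continuous R Y w (val p); exact.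
have [z [Uz Bz]] := Ucl n _ Bp.
have yz : d y z < r.
  have yun : d y (u n) < r / 2 by apply: (Mu n); rewrite /= leq_maxr.
  have unz : d (u n) z < r / 2.
    have [_ sV _] := VP N; apply: lt_trans Nr; apply: sV.
      by apply: (UV _ n) => //; rewrite leq_maxl.
    by apply: (UV _ n) => //; rewrite leq_maxl.
  by have := cm_triangle cm (u n) y z; lra.
apply: le_lt_trans (ler_distD (f z) _ _) _.
rewrite [e]splitr; apply: ltrD; first exact: rf.
by rewrite distrC; exact: Bz.
Qed.

(** * Paracompactness of metrizable spaces *)

(** Totality comes from the existence, and antisymmetry from the uniqueness, of a least element of
    [[set x; y]]. *)
Lemma exists_well_order (T : eqType) : exists le : T -> T -> Prop,
  [/\ forall x y, le x y \/ le y x, forall x y, le x y -> le y x -> x = y &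
    forall A : set T, A !=set0 -> exists2 x, A x & forall y, A y -> le x y].
Proof.
have [le wo] := well_ordering_principle T.
have least (A : set T) : A !=set0 -> exists2 x, A x & forall y, A y -> le x y.
  move=> [a Aa]; have [|x [[/set_mem Ax xA] _]] := wo (mem A).
    by exists a; exact: mem_set.
  by exists x => // y Ay; apply: xA; exact: mem_set.
exists le; split=> // [x y|x y xy yx].
  have [|z zxy zle] := least [set x; y]; first by exists x; left.
  by case: zxy zle => -> zle; [left|right]; apply: zle; [right|left].
have refl z : le z z.
  by have [|w -> /(_ z)] := least [set z]; [exists z|apply].
have [|z [_ uz]] := wo (mem [set x; y]).
  by exists x; apply/mem_set; left.
have <- : z = x.
  by apply: uz; split=> [|w /set_mem[->|->]]; [apply/mem_set; left|exact: refl|].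
by apply: uz; split=> [|w /set_mem[->|->]]; [apply/mem_set; right| |exact: refl].
Qed.

Section Stone.
Context (R : realType) (Y : topologicalType) (d : Y -> Y -> R).
Context (cm : complete_metric_on d).

Let e (n : nat) : R := 2^-1 ^+ n.

Let e_gt0 n : 0 < e n.
Proof. by rewrite exprn_gt0// invr_gt0. Qed.

Let e_half n : e n.+1 + e n.+1 = e n.
Proof. by rewrite /e exprS; lra. Qed.

Let e_le m n : (m <= n)%N -> e n <= e m.
Proof. by move=> mn; apply: ler_wiXn2l => //; lra. Qed.

Let e_small (r : R) : 0 < r -> exists n, e n < r.
Proof.
move=> r0; exists (Num.truncn r^-1).
rewrite /e exprVn invf_plt ?posrE ?exprn_gt0//.
apply: lt_le_trans (truncnS_gt _) _.
by rewrite -natrX ler_nat ltn_expl.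
Qed.

Lemma cm_open_ball y r : open [set z | d y z < r].
Proof.
rewrite openE => z /= yz; apply/(cm_nbhs cm); exists (r - d y z).
  by rewrite subr_gt0.
by move=> w /= zw; have := cm_triangle cm z y w; lra.
Qed.

(* M. E. Rudin's construction: the center [x] of a ball of the n-th stage is
   not covered by the set [E] of earlier stages, [B] is the first member of the
   cover containing [x], and the ball of triple radius around [x] stays in [B]. *)
Let stage (first : Y -> set Y) (E B : set Y) (n : nat) : set Y :=
  \bigcup_(x in [set x | [/\ first x = B, ~ E x &
    [set z | d x z < 3 * e n] `<=` B]]) [set z | d x z < e n].

Lemma complete_metric_paracompact : paracompact Y.
Proof.
split; first exact: (complete_metric_tychonoff cm).2.
move=> C [oC CT].
have [le [le_total le_anti le_least]] := exists_well_order (set Y).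
have /choice[first firstP] x : exists B, [/\ C B, B x &
    forall B', C B' -> B' x -> le B B'].
  have [|B [CB Bx] Ble] := le_least [set B | C B /\ B x].
    by have [B CB Bx] : (\bigcup_(U in C) U) x; [rewrite CT|exists B].
  by exists B; split=> // B' CB' Bx'; exact: Ble.
(* [E n] is the union of all stages before [n]. *)
pose fix E (n : nat) : set Y :=
  if n is m.+1 then E m `|` \bigcup_B stage first (E m) B m else set0.
pose D B n := stage first (E n) B n.
have oD B n : open (D B n) by apply: bigcup_open => x _; exact: cm_open_ball.
have DB B n : D B n `<=` B.
  move=> z [x [_ _ xB] /= xz]; apply: xB => /=; apply: lt_le_trans xz _.
  by have := e_gt0 n; lra.
have DE B m n : (m < n)%N -> D B m `<=` E n.
  elim: n => // n IH; rewrite ltnS leq_eqVlt => /orP[/eqP <- z Dz|/IH DE z /DE].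
    by right; exists B.
  by left.
have ED n x : E n x -> exists B m, C B /\ D B m x.
  elim: n => [//|n IH [/IH //|[B _ Dx]]].
  exists B, n; split=> //; have [z [<- _ _] _] := Dx.
  by have [] := firstP z.
have Dcover x : exists B n, C B /\ D B n x.
  have [CB Bx _] := firstP x.
  have /(cm_nbhs cm)[r r0 rB] : nbhs x (first x).
    by apply: open_nbhs_nbhs; split=> //; exact: oC.
  (* For this [n], a point [x] not covered earlier is itself a center of stage [n] for [first x]. *)
  have [n nr] : exists n, e n < r / 3 by apply: e_small; rewrite divr_gt0.
  have [/ED//|nE] := pselect (E n x).
  exists (first x), n; split=> //; exists x => /=; last by rewrite (cm_xx cm).
  split=> // z /= xz; apply: rB => /=; lra.
exists [set V | exists B n, C B /\ V = D B n]; split.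
- split; first by move=> _ [B [n [_ ->]]].
  apply/seteqP; split=> // x _; have [B [n [CB Dx]]] := Dcover x.
  by exists (D B n) => //; exists B, n.
- by move=> _ [B [n [CB ->]]]; exists B.
move=> x; have [A [n [CA Dx]]] := Dcover x.
have /(cm_nbhs cm)[r r0 rD] : nbhs x (D A n) by exact: open_nbhs_nbhs.
have [j jr] := e_small r0.
pose k := (n + j).+1.
exists [set z | d x z < e k]; first exact: cm_nbhs_ball.
(* From stage [k] on, a ball meeting this neighborhood would have its center within [e i + e k < r]
   of [x], hence in [D A n], which belongs to an earlier stage. *)
have meet_lt B i : D B i `&` [set z | d x z < e k] !=set0 -> (i < k)%N.
  move=> [w [[y [_ nEy _] /= yw] /= xw]]; rewrite ltnNge; apply/negP => ki.
  apply: nEy; apply: (DE A n).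
    by apply: leq_trans ki; rewrite /k ltnS leq_addr.
  apply: rD => /=.
  have ei : e i <= e k by exact: e_le.
  have ek : e k + e k <= e j.
    by rewrite /k e_half; apply: e_le; rewrite leq_addl.
  have := cm_triangle cm w x y; rewrite (cm_sym cm w y); lra.
(* Before stage [k], twice [e k] is at most [e i], so the centers [y] and [z] are less than
   [3 * e i] apart. Hence [z] lies in [B], and minimality of [first z] forces equality. *)
have meet_le B B' i : (i < k)%N -> C B -> le B B' ->
    D B i `&` [set z | d x z < e k] !=set0 ->
    D B' i `&` [set z | d x z < e k] !=set0 -> B = B'.
  move=> ik CB BB' [p [[y [_ _ yB] /= yp] /= xp]].
  move=> [q [[z [zB' _ _] /= zq] /= xq]].
  apply: le_anti => //; rewrite -zB'; have [_ _] := firstP z; apply => //.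
  apply: yB => /=.
  have ek : e k + e k <= e i by rewrite /k e_half; apply: e_le.
  have := cm_triangle cm p y z; have := cm_triangle cm x p z.
  have := cm_triangle cm q x z; rewrite (cm_sym cm p x) (cm_sym cm q z).
  lra.
have meet_uniq B B' i : C B -> C B' ->
    D B i `&` [set z | d x z < e k] !=set0 ->
    D B' i `&` [set z | d x z < e k] !=set0 -> B = B'.
  move=> CB CB' mB mB'; have ik := meet_lt _ _ mB.
  by have [le1|le1] := le_total B B'; [|apply/esym]; exact: (meet_le _ _ i).
(* [V i] is the only set of stage [i] that can meet the neighborhood, or [set0] if there is none. *)
have /choice[V VP] i : exists V, forall B, C B ->
    D B i `&` [set z | d x z < e k] !=set0 -> D B i = V.
  have [[B [CB mB]]|nB] := pselect (exists B, C B /\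
      D B i `&` [set z | d x z < e k] !=set0).
    by exists (D B i) => B' CB' mB'; rewrite (meet_uniq B B' i).
  by exists set0 => B CB mB; exfalso; apply: nB; exists B.
apply: (@sub_finite_set _ _ (V @` `I_k)); last exact: finite_image (finite_II k).
move=> _ [[B [i [CB ->]]] mB]; exists i; first exact: (meet_lt B).
by rewrite (VP i B).
Qed.

End Stone.

(** * The uniform metric on the space of continuous functions *)

Section UniformDistance.
Context (R : realType) (kappa : Type) (X : topologicalType).
Implicit Types f g h : Caleph R kappa X.

(** Truncation at 1 keeps the supremum finite for unbounded differences. *)
Definition udist f g : R :=
  sup (range (fun x => Num.min 1 `|Ceval f x - Ceval g x|)).

Lemma min_le_udist f g x : Num.min 1 `|Ceval f x - Ceval g x| <= udist f g.
Proof.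
apply: ub_le_sup; last by exists x.
by exists 1 => _ [y _ <-]; rewrite ge_min lexx.
Qed.

Lemma udist_le f g r : 0 <= r ->
  (forall x, Num.min 1 `|Ceval f x - Ceval g x| <= r) -> udist f g <= r.
Proof.
move=> r0 fg; rewrite /udist; set S := [set _ | _ in _].
(* For empty [X] the supremum takes the default value 0, whence the hypothesis [0 <= r]. *)
have [->|/set0P S0] := eqVneq S set0; first by rewrite sup0.
by apply: ge_sup => // _ [x _ <-]; exact: fg.
Qed.

Lemma udist_ge0 f g : 0 <= udist f g.
Proof.
rewrite /udist; set S := [set _ | _ in _].
have [->|/set0P[_ [x _ _]]] := eqVneq S set0; first by rewrite sup0.
by apply: le_trans (min_le_udist f g x); rewrite le_min ler01 normr_ge0.
Qed.

Lemma dist_le_udist f g x : udist f g < 1 ->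
  `|Ceval f x - Ceval g x| <= udist f g.
Proof.
move=> fg1; have := min_le_udist f g x.
by have [_|//] := leP 1 `|Ceval f x - Ceval g x|; rewrite leNgt fg1.
Qed.

Context (kappa_uncountable : ~ countable [set: kappa]).

(** A bound on the dense set [D] extends to [X] by continuity, so a single ball over [D] controls
    the uniform distance. *)
Lemma nbhs_udist f A (D : set X) : dense D -> card_lt D [set: kappa] ->
  nbhs f A <-> exists2 e, 0 < e & [set g | udist f g < e] `<=` A.
Proof.
move=> dD Dk; split.
  move=> /(nbhs_C_ball _ _ kappa_uncountable)[B [e [_ e0 BA]]].
  exists (Num.min 1 e); first by rewrite lt_min ltr01.
  move=> g /=; rewrite lt_min => /andP[fg1 fge]; apply: BA; apply/C_ballP.
  by exists (udist f g) => // x _; exact: dist_le_udist.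
move=> [e e0 eA]; apply/(nbhs_C_ball _ _ kappa_uncountable).
exists D, (e / 2); split=> //; first by rewrite divr_gt0.
move=> g /C_ballP[r re fg]; apply: eA => /=.
apply: (@le_lt_trans _ _ (e / 2)); last by lra.
apply: udist_le => [|x]; first by rewrite divr_ge0// ltW.
rewrite ge_min; apply/orP; right; rewrite leNgt; apply/negP => fge.
pose u x := `|Ceval f x - Ceval g x|.
have cu : continuous u.
  move=> y; apply: (@cvg_norm _ R^o); apply: cvgB; exact: cts_fun.
have [|y [/= ey Dy]] := dD (u @^-1` [set r | e / 2 < r]) (ex_intro _ x fge).
  by move/continuousP : cu; apply; exact: open_gt.
by have := lt_trans (le_lt_trans (fg y Dy) re) ey; rewrite ltxx.
Qed.

Lemma udist_complete (u : nat -> Caleph R kappa X) (D : set X) :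
  dense D -> card_lt D [set: kappa] ->
  (forall e, 0 < e -> exists N, forall m n, (N <= m)%N -> (N <= n)%N ->
    udist (u m) (u n) < e) ->
  exists l : Caleph R kappa X, u @ \oo --> l.
Proof.
move=> dD Dk uc.
have ucx e : 0 < e -> exists N, forall m n x, (N <= m)%N -> (N <= n)%N ->
    `|Ceval (u m) x - Ceval (u n) x| < e.
  move=> e0; have [|N NP] := uc (Num.min 1 e); first by rewrite lt_min ltr01.
  exists N => m n x Nm Nn; have := NP m n Nm Nn.
  by rewrite lt_min => /andP[mn1]; apply: le_lt_trans; exact: dist_le_udist.
have /choice[l lP] x : exists l : R, (fun n => Ceval (u n) x) @ \oo --> l.
  apply/cvg_ex/cauchy_cvgP/cauchyP => e e0.
  have [N NP] := ucx e e0; exists (Ceval (u N) x), N => // n Nn.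
  by apply: NP => //=.
have ul e : 0 < e -> exists N, forall n x, (N <= n)%N ->
    `|Ceval (u n) x - l x| <= e.
  move=> e0; have [N NP] := ucx e e0; exists N => n x Nn.
  apply/ler_addgt0Pl => r r0.
  (* [M] depends on [x] and [r], but [N] does not, so the convergence is uniform and the limit
     continuous. *)
  have /cvgrPdist_lt/(_ r r0)[M _ Ml] := lP x.
  have /= := Ml (maxn N M) (leq_maxr _ _).
  have := NP n (maxn N M) x Nn (leq_maxl _ _).
  have := ler_distD (Ceval (u (maxn N M)) x) (Ceval (u n) x) (l x).
  rewrite (distrC (l x)); lra.
have cl : continuous l.
  move=> x; apply/cvgrPdist_lt => e e0.
  have e30 : 0 < e / 3 by rewrite divr_gt0.
  have [N /(_ N _ (leqnn N)) NP] := ul _ e30.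
  have /cvgrPdist_lt/(_ _ e30) : Ceval (u N) y @[y --> x] --> Ceval (u N) x.
    exact: cts_fun.
  apply: filterS => y uxy; have := NP x; have := NP y; rewrite (distrC _ (l x)).
  have := ler_distD (Ceval (u N) x) (l x) (l y).
  have := ler_distD (Ceval (u N) y) (Ceval (u N) x) (l y).
  lra.
exists (C_of kappa cl) => A /(nbhs_udist _ _ dD Dk)[e e0 eA].
have e20 : 0 < e / 2 by rewrite divr_gt0.
have [N NP] := ul _ e20; exists N => // n /= Nn; apply: eA => /=.
apply: (@le_lt_trans _ _ (e / 2)); last by lra.
apply: udist_le => [|x]; first exact: ltW.
by rewrite ge_min Ceval_C_of distrC NP// orbT.
Qed.

Lemma udist_complete_metric (D : set X) :
  dense D -> card_lt D [set: kappa] -> complete_metric_on udist.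
Proof.
move=> dD Dk; split.
- move=> f; apply/eqP; rewrite eq_le udist_ge0 andbT.
  by apply: udist_le => // x; rewrite subrr normr0 ge_min lexx orbT.
- move=> f g fg; apply/continuousEP => x; apply/eqP.
  rewrite -subr_eq0 -normr_le0 -fg; apply: dist_le_udist.
  by rewrite fg ltr01.
- by move=> f g; rewrite /udist; under eq_fun do rewrite distrC.
- move=> g f h; apply: udist_le; first by rewrite addr_ge0// udist_ge0.
  move=> x; apply: le_trans (lerD (min_le_udist f g x) (min_le_udist g h x)).
  have := ler_distD (Ceval g x) (Ceval f x) (Ceval h x).
  have := normr_ge0 (Ceval f x - Ceval g x).
  have := normr_ge0 (Ceval g x - Ceval h x).
  (* A summand truncated to 1 dominates alone; otherwise this is the usual triangle inequality. *)
  rewrite ge_min; case: (leP 1 `|Ceval f x - Ceval g x|) => ?;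
    case: (leP 1 `|Ceval g x - Ceval h x|) => ? ? ? ?; apply/orP;
    [left|left|left|right]; lra.
- by move=> f A; exact: nbhs_udist dD Dk.
- by move=> u; exact: udist_complete dD Dk.
Qed.

End UniformDistance.

(** * The equivalences *)

(** Local Cech-completeness is shown with the whole space as neighborhood, which then appears as a
    subtype and needs the metric transferred to it. *)
Lemma complete_metric_on_setT (R : realType) (Y : topologicalType)
    (d : Y -> Y -> R) : complete_metric_on d ->
  complete_metric_on (fun x y : set_type [set: Y] => d (val x) (val y)).
Proof.
move=> cm; pose T (y : Y) : set_type [set: Y] := exist _ y (mem_set I).
have nE (y : set_type [set: Y]) A : nbhs y A <-> nbhs (val y) (T @^-1` A).
  split=> [[_ [[B oB <-] By BA]]|yA].
    apply: (@filterS _ _ _ B) => [z Bz|]; first exact: (BA (T z)).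
    exact: open_nbhs_nbhs.
  apply: (@filterS _ _ _ (set_val @^-1` (T @^-1` A))).
    move=> z; suff : T (set_val z) = z by rewrite /preimage /= => ->.
    exact: val_inj.
  exact: (@initial_continuous _ _ (set_val : set_type [set: Y] -> Y) y).
split.
- by move=> x; exact: cm_xx cm _.
- by move=> x y /(cm_eq cm)/val_inj.
- by move=> x y; exact: cm_sym cm _ _.
- by move=> y x z; exact: cm_triangle cm _ _ _.
- move=> y A; split=> [/nE/(cm_nbhs cm)[e e0 eA]|[e e0 eA]].
    exists e => // z /eA; suff : T (val z) = z by rewrite /preimage /= => ->.
    exact: val_inj.
  by apply/nE/(cm_nbhs cm); exists e => // z dz; exact: eA.
- move=> u uc; have [l ul] := cm_complete cm (u := fun n => val (u n)) uc.
  exists (T l) => A /nE /ul; apply: (@filterS _ \oo) => n /=.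
  by suff -> : T (val (u n)) = u n by []; exact: val_inj.
Qed.

Theorem theorem4p2 (R : realType) (X : topologicalType) (kappa : Type)
    (X_tychonoff : tychonoff_space X)
    (kappa_uncountable : ~ countable [set: kappa]) :
  [<-> completely_metrizable R (Caleph R kappa X);
       cech_complete R (Caleph R kappa X);
       locally_cech_complete R (Caleph R kappa X);
       exists Z : topologicalType,
         [/\ paracompact Z, cech_complete R Z
           & open_continuous_image Z (Caleph R kappa X)];
       exists Z : topologicalType,
         cech_complete R Z /\ open_continuous_image Z (Caleph R kappa X);
       pointwise_countable_type (Caleph R kappa X);
       aleph_separable kappa X].
Proof.
(* Every condition that gives pointwise countable type also gives separability and then a compatible
   complete metric; the steps of the cycle draw on this metric. *)
have metric_1 : completely_metrizable R (Caleph R kappa X) ->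
    exists d : Caleph R kappa X -> Caleph R kappa X -> R, complete_metric_on d.
  exact: completely_metrizable_metric.
have h71 : aleph_separable kappa X ->
    completely_metrizable R (Caleph R kappa X).
  move=> /(aleph_separableP _ kappa_uncountable)[D dD Dk].
  apply: complete_metric_completely_metrizable.
  exact: (udist_complete_metric _ kappa_uncountable dD Dk).
have h61 : pointwise_countable_type (Caleph R kappa X) ->
    completely_metrizable R (Caleph R kappa X).
  by move=> /(pointwise_countable_type_separable kappa_uncountable X_tychonoff).
have h26 := @cech_complete_pointwise_countable_type R (Caleph R kappa X).
have h56 : (exists Z : topologicalType,
    cech_complete R Z /\ open_continuous_image Z (Caleph R kappa X)) ->
    pointwise_countable_type (Caleph R kappa X).
  move=> [Z [cZ ZC]]; apply: open_continuous_image_pointwise_countable_type ZC _.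
  exact: cech_complete_pointwise_countable_type cZ.
tfae.
- by move=> /metric_1[d]; exact: complete_metric_cech_complete.
- move=> /h26/h61/metric_1[d cm]; split.
    exact: complete_metric_tychonoff cm.
  move=> f; exists setT; first exact: filterT.
  exact: complete_metric_cech_complete (complete_metric_on_setT cm).
- move=> /locally_cech_complete_pointwise_countable_type/h61/metric_1[d cm].
  exists (Caleph R kappa X); split.
  + exact: complete_metric_paracompact cm.
  + exact: complete_metric_cech_complete cm.
  + exists id; split=> [f A //|U oU|f]; last by exists f.
    by rewrite image_id.
- by move=> [Z [_ cZ ZC]]; exists Z.
- exact: h56.
- exact: pointwise_countable_type_separable.
- exact: h71.
Qed.
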